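(* Let $X$ be a locally compact, separable, metrizable space whose quasi-component space $Q(X)$ is compact. If $X$ is equipped with the Freudenthal coarse proximity structure $(X,\mathcal{B}_C,\mathbf{b}_F)$, then $$asInd(X)=Ind(\mathcal{U}X)=Ind(FX\setminus X),$$ where $FX$ is the Freudenthal compactification of $X$.
   Context: Quasi-components. The quasi-component of a point $x\in X$ is the intersection of all clopen subsets of $X$ containing $x$. The quasi-component space $Q(X)$ is the set of quasi-components of $X$ with the topology generated by the clopen subsets of $X$. Proximities and Smirnov compactifications. A proximity on $X$ is a relation $\delta$ on the power set of $X$ that is symmetric; satisfies $A\delta B\Rightarrow A,B\ne\emptyset$; $A\cap B\neq\emptyset\Rightarrow A\delta B$; $A\delta(B\cup C)\iff A\delta B$ or $A\delta C$; and if $A\bar\delta B$ (negation) then there is $E\subseteq X$ with $A\bar\delta E$ and $(X\setminus E)\bar\delta B$. It is separated if $\{x\}\delta\{y\}\iff x=y$. A cluster of a separated proximity space $(X,\delta)$ is a collection $\sigma$ of nonempty subsets of $X$ such that $A\delta B$ for all $A,B\in\sigma$; if $C\delta A$ for all $A\in\sigma$ then $C\in\sigma$; and if $A\cup B\in\sigma$ then $A\in\sigma$ or $B\in\sigma$. The Smirnov compactification of $(X,\delta)$ is the set $\mathfrak{X}$ of all clusters with the separated proximity $\delta^*$: $\mathcal{A}\delta^*\mathcal{C}$ iff $A\delta C$ for all $A,C\subseteq X$ such that $A\in\sigma$ for every $\sigma\in\mathcal{A}$ and $C\in\sigma$ for every $\sigma\in\mathcal{C}$. Its topology (closure of $\mathcal{A}$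 is $\{\sigma:\{\sigma\}\delta^*\mathcal{A}\}$) is compact Hausdorff, and $X$ is identified with the dense set of point clusters (those containing a singleton); then $cl_{\mathfrak{X}}(A)=\{\sigma\in\mathfrak{X}:A\in\sigma\}$ for $A\subseteq X$. Freudenthal structures. For a locally compact Hausdorff space $X$, the Freudenthal proximity $\delta_F$ is: $A\bar\delta_FB$ iff there is a compact $K\subseteq X$ disjoint from $A$ and $B$ such that $X\setminus K$ is the union of two disjoint open sets $U_1\supseteq A$ and $U_2\supseteq B$. It is a separated proximity; its Smirnov compactification is the Freudenthal compactification $FX$, and $FX\setminus X$ is the Freudenthal boundary. The Freudenthal coarse proximity structure is $(X,\mathcal{B}_C,\mathbf{b}_F)$ with $\mathcal{B}_C$ the collection of subsets of $X$ with compact closure, and $A\mathbf{b}_FB\iff(A\setminus D)\delta_F(B\setminus D)$ for all $D\in\mathcal{B}_C$. Coarse proximity spaces. A bornology on a set $X$ is a family $\mathcal{B}$ of subsets of $X$ that contains all singletons, is closed under taking subsets, and is closed under unions of two members. Members of $\mathcal{B}$ are called bounded; other subsets are unbounded. A coarse proximity space is a triple $(X,\mathcal{B},\mathbf{b})$ where $\mathcal{B}$ is a bornology on $X$ and $\mathbf{b}$ is a relation on the power set of $X$ such that for all $A,B,C\subseteq X$ (writing $\bar{\mathbf{b}}$ for the negation of $\mathbf{b}$): (1) $A\mathbf{b}B\Rightarrow B\mathbf{b}A$; (2) $A\mathbf{b}B\Rightarrow A,B\notin\mathcal{B}$; (3) $A\cap B\notin\mathcal{B}\Rightarrow A\mathbf{b}B$;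 (4) $(A\cup B)\mathbf{b}C\iff A\mathbf{b}C$ or $B\mathbf{b}C$; (5) $A\bar{\mathbf{b}}B\Rightarrow$ there is $E\subseteq X$ with $A\bar{\mathbf{b}}E$ and $(X\setminus E)\bar{\mathbf{b}}B$. The Freudenthal coarse proximity structure is one. A subset $Y\subseteq X$ carries the subspace coarse proximity structure: bornology $\{B\cap Y: B\in\mathcal{B}\}$, and $A\mathbf{b}_YC\iff A\mathbf{b}C$ for $A,C\subseteq Y$. The discrete extension of $\mathbf{b}$ is the separated proximity $A\delta B\iff(A\cap B\neq\emptyset$ or $A\mathbf{b}B)$; with $\mathfrak{X}$ the Smirnov compactification of $(X,\delta)$, the boundary $\mathcal{U}X\subseteq\mathfrak{X}$ is the subspace of clusters containing no bounded set (it is compact Hausdorff), and the trace of $A\subseteq X$ is $A'=cl_{\mathfrak{X}}(A)\cap\mathcal{U}X$. Dimensions. A separator between disjoint subsets $A,B$ of a topological space $T$ is a set $C\subseteq T$ such that $T\setminus C=U\cup V$ with $U,V$ disjoint open in $T$, $A\subseteq U$, $B\subseteq V$. The large inductive dimension of a normal space $T$: $Ind(T)=-1$ iff $T=\emptyset$; for $n\ge 0$, $Ind(T)\le n$ if for every pair of disjoint closed $A,B\subseteq T$ there is a separator $C$ between them with $Ind(C)\le n-1$; $Ind(T)=n$ if $n\ge -1$ is the smallest integer with $Ind(T)\le n$; $Ind(T)=\infty$ if there is no such integer. If $A\bar{\mathbf{b}}B$ in $X$, an asymptotic separator between $A$ and $B$ is a set $C\subseteq X$ such that $C'$ is a separator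 in $\mathcal{U}X$ between $A'$ and $B'$. The asymptotic inductive dimension: $asInd(X)=-1$ iff $X$ is bounded; for $n\ge0$, $asInd(X)\le n$ if for all $A,B\subseteq X$ with $A\bar{\mathbf{b}}B$ there is an asymptotic separator $C\subseteq X$ between $A$ and $B$ with $asInd(C)\le n-1$ ($C$ with the subspace coarse proximity structure); $asInd(X)=n$ if $n\ge-1$ is the smallest integer with $asInd(X)\le n$; $asInd(X)=\infty$ if there is no such integer.
   Formalization: The Freudenthal proximity is defined by separating the closures of A and B by a compact set, since without closures it is not a proximity (in [0,1], the sets [0,1/2) and (1/2,1] violate the splitting axiom); the coarse structure is unchanged. *)

(* Defs.v *)
From HB Require Import structures.
From mathcomp Require Import all_boot all_order all_algebra.
From mathcomp Require Import all_classical all_reals.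
From mathcomp Require Import ereal topology.

Set Implicit Arguments.
Unset Strict Implicit.
Unset Printing Implicit Defensive.

Import Order.TTheory GRing.Theory Num.Theory.

Local Open Scope classical_set_scope.

Definition separable_space (T : topologicalType) : Prop :=
  exists2 D : set T, countable D & dense D.

Definition metrizable (R : realType) (T : topologicalType) : Prop :=
  exists d : T -> T -> R,
    [/\ forall x y, d x y = 0%R <-> x = y,
        forall x y, d x y = d y x,
        forall x y z, (d x z <= d x y + d y z)%R &
        forall x, nbhs x =
          filter_from [set e : R | (0 < e)%R]
                      (fun e => [set y | (d x y < e)%R])].

Lemma metrizable_hausdorff (R : realType) (T : topologicalType) :
  metrizable R T -> hausdorff_space T.
Proof.
move=> [d [d0 dC dT dN]] x y xy; apply: contrapT => /d0 dxy.
have dge0 u v : (0 <= d u v)%R.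
  have := dT u v u; rewrite (dC v u) (proj2 (d0 u u) erefl) -mulr2n.
  by rewrite pmulrn_lge0.
have e0 : (0 < d x y / 2)%R.
  by rewrite divr_gt0 ?ltr0n// lt_neqAle dge0 andbT eq_sym; exact/eqP.
have nb z : nbhs z [set w | (d z w < d x y / 2)%R].
  by rewrite dN; exists (d x y / 2)%R.
have [z [/= xz yz]] := xy _ _ (nb x) (nb y).
have := dT x z y; rewrite (dC z y) leNgt => /negP; apply.
by rewrite [ltRHS]splitr ltrD.
Qed.

Arguments metrizable_hausdorff {R T} _ [p q] _.

Section QuasiComponents.
Variable X : topologicalType.

Definition quasi_component (x : X) : set X :=
  \bigcap_(U in [set U | clopen U /\ U x]) U.

Definition quasi_component_space : Type :=
  set_type (range quasi_component).

HB.instance Definition _ := Choice.on quasi_component_space.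

(* A clopen set is a union of quasi-components, so it is also a set of
   points of the quasi-component space. *)
HB.instance Definition _ :=
  @isSubBaseTopological.Build quasi_component_space (set X) (@clopen X)
    (fun U => [set q | val q `<=` U]).

End QuasiComponents.

Record proximity (X : Type) := Proximity {
  prox :> set X -> set X -> Prop;
  prox_sym : forall A B, prox A B -> prox B A;
  prox_neq0 : forall A B, prox A B -> A !=set0 /\ B !=set0;
  prox_meet : forall A B, A `&` B !=set0 -> prox A B;
  proxU : forall A B C, prox A (B `|` C) <-> prox A B \/ prox A C;
  prox_split : forall A B, ~ prox A B ->
    exists E, ~ prox A E /\ ~ prox (~` E) B;
  prox_separated : forall x y, prox [set x] [set y] <-> x = y
}.

Section Smirnov.
Variables (X : Type) (delta : proximity X).

Record prox_cluster := ProxCluster {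
  cluster_sets :> set X -> Prop;
  cluster_neq0 : forall A, cluster_sets A -> A !=set0;
  cluster_near : forall A B, cluster_sets A -> cluster_sets B -> delta A B;
  cluster_max : forall C, (forall A, cluster_sets A -> delta C A) ->
    cluster_sets C;
  clusterU : forall A B, cluster_sets (A `|` B) ->
    cluster_sets A \/ cluster_sets B
}.

HB.instance Definition _ := gen_eqMixin prox_cluster.
HB.instance Definition _ := gen_choiceMixin prox_cluster.

Definition absorbs (A : set X) (S : set prox_cluster) : Prop :=
  forall sigma, S sigma -> sigma A.

Definition smirnov_prox (S T : set prox_cluster) : Prop :=
  forall A C, absorbs A S -> absorbs C T -> delta A C.

Lemma prox_sub A B B' : B `<=` B' -> delta A B -> delta A B'.
Proof. by move=> /setUidPr <- AB; apply/proxU; left. Qed.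

Lemma cluster_sub (sigma : prox_cluster) A B :
  A `<=` B -> sigma A -> sigma B.
Proof.
move=> AB sA; apply: cluster_max => C sC.
apply/prox_sym; exact/(prox_sub AB)/(cluster_near sC sA).
Qed.

Lemma smirnov_prox1P (sigma : prox_cluster) S :
  smirnov_prox [set sigma] S <-> forall C, absorbs C S -> sigma C.
Proof.
split=> [sS C CS|H A C As CS].
  apply: cluster_max => A sA; apply: prox_sym; apply: sS => //.
  by move=> _ ->.
exact: (cluster_near (As _ erefl) (H _ CS)).
Qed.

Definition smirnov_open (O : set prox_cluster) : Prop :=
  forall sigma, O sigma -> ~ smirnov_prox [set sigma] (~` O).

Lemma smirnov_openT : smirnov_open setT.
Proof.
move=> sigma _ /smirnov_prox1P /(_ set0) s0.
have /cluster_neq0[//] : sigma set0 by apply: s0 => tau; rewrite setCT.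
Qed.

Lemma smirnov_openI : setI_closed smirnov_open.
Proof.
move=> O P oO oP sigma [sO sP]; rewrite setCI => /smirnov_prox1P sOP.
apply: (oO _ sO); apply/smirnov_prox1P => C CO; apply: contrapT => nC.
apply: (oP _ sP); apply/smirnov_prox1P => D DP.
have /clusterU[] // : sigma (C `|` D).
apply: sOP => tau [/CO|/DP] t; apply: cluster_sub t => ? ?; by [left|right].
Qed.

Lemma smirnov_open_bigU (I : Type) (f : I -> set prox_cluster) :
  (forall i, smirnov_open (f i)) -> smirnov_open (\bigcup_i f i).
Proof.
move=> of_ sigma [i _ sfi] /smirnov_prox1P sU; apply: (of_ i _ sfi).
apply/smirnov_prox1P => C Cf; apply: sU => tau ntau; apply: Cf => tfi.
by apply: ntau; exists i.
Qed.

HB.instance Definition _ :=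
  @isOpenTopological.Build prox_cluster smirnov_open smirnov_openT
    smirnov_openI smirnov_open_bigU.

Lemma closure_smirnovE (S : set prox_cluster) :
  closure S = [set sigma | smirnov_prox [set sigma] S].
Proof.
apply/seteqP; split=> [|sigma /= sS].
  have clS : closed [set sigma | smirnov_prox [set sigma] S].
    rewrite -openC /open/= => sigma /= nsS; rewrite setCK => sc.
    apply: nsS; apply/smirnov_prox1P => C CS.
    by move/smirnov_prox1P: sc; apply => tau /smirnov_prox1P; exact.
  rewrite [X in _ `<=` X](closure_id _).1//; apply: closureS => sigma sS.
  by apply/smirnov_prox1P => C; exact.
move=> U; rewrite nbhsE => -[O [oO Os] OU]; apply: contrapT => SU.
apply: (oO _ Os); apply/smirnov_prox1P => C CO.
move/smirnov_prox1P: sS; apply => tau St; apply: CO => Ot.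
by apply: SU; exists tau; split=> //; exact: OU.
Qed.

(* A as a subset of the Smirnov compactification: x is identified with the
   cluster that contains [set x]. *)
Definition point_clusters (A : set X) : set prox_cluster :=
  [set sigma | exists2 x, A x & sigma [set x]].

End Smirnov.

Arguments point_clusters {X} delta A.

Section Separators.

Definition separator (T : topologicalType) (A B C : set T) : Prop :=
  exists U V : set T,
    [/\ open U /\ open V, U `&` V = set0, ~` C = U `|` V,
        A `<=` U & B `<=` V].

(* [Ind_lt n T] means Ind(T) <= n - 1. *)
Fixpoint Ind_lt (n : nat) (T : topologicalType) : Prop :=
  if n is m.+1 then
    forall A B : set T, closed A -> closed B -> A `&` B = set0 ->
      exists2 C : set T, separator A B C & Ind_lt m (set_type C)
  else [set: T] = set0.

(* The smallest n - 1 such that [P n], and +oo if there is none. *)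
Definition least_dim (P : nat -> Prop) : \bar int :=
  if pselect (exists n, `[< P n >]) is left ex
  then ((ex_minn ex)%:Z - 1)%R%:E else +oo%E.

Definition Ind (T : topologicalType) : \bar int :=
  least_dim (fun n => Ind_lt n T).

End Separators.

Record coarse_proximity (X : Type) := CoarseProximity {
  bounded_set : set (set X);
  cprox : set X -> set X -> Prop;
  (* Implied by the next two axioms unless X is empty. *)
  bounded_set0 : bounded_set set0;
  bounded_set1 : forall x, bounded_set [set x];
  bounded_subset : forall A B, A `<=` B -> bounded_set B -> bounded_set A;
  bounded_setU : forall A B, bounded_set A -> bounded_set B ->
    bounded_set (A `|` B);
  cprox_sym : forall A B, cprox A B -> cprox B A;
  cprox_unbounded : forall A B, cprox A B ->
    ~ bounded_set A /\ ~ bounded_set B;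
  cprox_meet : forall A B, ~ bounded_set (A `&` B) -> cprox A B;
  cproxU : forall A B C, cprox (A `|` B) C <-> cprox A C \/ cprox B C;
  cprox_split : forall A B, ~ cprox A B ->
    exists E, ~ cprox A E /\ ~ cprox (~` E) B
}.

Section CoarseProximity.
Variables (X : Type) (b : coarse_proximity X).

Lemma cprox_sub A A' B B' : A `<=` A' -> B `<=` B' ->
  cprox b A B -> cprox b A' B'.
Proof.
move=> /setUidPr <- /setUidPr <- AB; apply/cproxU; left.
by apply/cprox_sym/cproxU; left; exact: cprox_sym.
Qed.

Section Subspace.
Variable Y : set X.

Definition sbounded (S : set (set_type Y)) : Prop :=
  exists2 B, bounded_set b B & S = set_val @^-1` B.

Definition sprox (S T : set (set_type Y)) : Prop :=
  cprox b (set_val @` S) (set_val @` T).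

Lemma sboundedE S : sbounded S <-> bounded_set b (set_val @` S).
Proof.
split=> [[B bB ->]|bS]; first by apply: bounded_subset bB => _ [y By <-].
exists (set_val @` S) => //; apply/seteqP; split=> [y Sy|y [z Sz]].
  by exists y.
by move=> /val_inj <-.
Qed.

Lemma sbounded0 : sbounded set0.
Proof. by apply/sboundedE; rewrite image_set0; exact: bounded_set0. Qed.

Lemma sbounded1 x : sbounded [set x].
Proof. by apply/sboundedE; rewrite image_set1; exact: bounded_set1. Qed.

Lemma sbounded_sub A B : A `<=` B -> sbounded B -> sbounded A.
Proof.
move=> AB /sboundedE bB; apply/sboundedE.
by apply: bounded_subset bB; exact: image_subset.
Qed.

Lemma sboundedU A B : sbounded A -> sbounded B -> sbounded (A `|` B).
Proof.
move=> /sboundedE bA /sboundedE bB; apply/sboundedE.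
by rewrite image_setU; exact: bounded_setU.
Qed.

Lemma sprox_sym A B : sprox A B -> sprox B A.
Proof. exact: cprox_sym. Qed.

Lemma sprox_unb A B : sprox A B -> ~ sbounded A /\ ~ sbounded B.
Proof. by move=> /cprox_unbounded[uA uB]; split=> /sboundedE. Qed.

Lemma sprox_meet A B : ~ sbounded (A `&` B) -> sprox A B.
Proof.
move=> uAB; apply: cprox_meet => bI; apply: uAB; apply/sboundedE.
by apply: bounded_subset bI => _ [x [Ax Bx] <-]; split; exists x.
Qed.

Lemma sproxU A B C : sprox (A `|` B) C <-> sprox A C \/ sprox B C.
Proof. by rewrite /sprox image_setU; exact: cproxU. Qed.

Lemma sprox_split A B : ~ sprox A B -> exists E, ~ sprox A E /\ ~ sprox (~` E) B.
Proof.
move=> /cprox_split[E [AE EB]]; exists (set_val @^-1` E); split=> H.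
  by apply: AE; apply: cprox_sub H => // _ [x Ex <-].
by apply: EB; apply: cprox_sub H => // _ [x Ex <-].
Qed.

Definition coarse_sub : coarse_proximity (set_type Y) :=
  @CoarseProximity _ sbounded sprox sbounded0 sbounded1 sbounded_sub sboundedU
    sprox_sym sprox_unb sprox_meet sproxU sprox_split.

End Subspace.

Definition dprox (A B : set X) : Prop := A `&` B !=set0 \/ cprox b A B.

Lemma dprox_sym A B : dprox A B -> dprox B A.
Proof. by move=> [?|/cprox_sym]; [left; rewrite setIC|right]. Qed.

Lemma dprox_neq0 A B : dprox A B -> A !=set0 /\ B !=set0.
Proof.
have unb (C : set X) : ~ bounded_set b C -> C !=set0.
  move=> uC; apply/set0P/eqP => C0; apply: uC.
  by rewrite C0; exact: bounded_set0.
move=> [[x [Ax Bx]]|/cprox_unbounded[uA uB]]; first by split; exists x.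
by split; exact: unb.
Qed.

Lemma dprox_meet A B : A `&` B !=set0 -> dprox A B.
Proof. by left. Qed.

Lemma dproxU A B C : dprox A (B `|` C) <-> dprox A B \/ dprox A C.
Proof.
split=> [[[x [Ax [Bx|Cx]]]|/cprox_sym/cproxU[]/cprox_sym ?]|].
- by left; left; exists x.
- by right; left; exists x.
- by left; right.
- by right; right.
- move=> [[[x [Ax Bx]]|AB]|[[x [Ax Cx]]|AC]].
  + by left; exists x; split=> //; left.
  + by right; apply/cprox_sym/cproxU; left; exact: cprox_sym.
  + by left; exists x; split=> //; right.
  + by right; apply/cprox_sym/cproxU; right; exact: cprox_sym.
Qed.

Lemma dprox_split A B : ~ dprox A B ->
  exists E, ~ dprox A E /\ ~ dprox (~` E) B.
Proof.
move=> nAB; have nI : ~ (A `&` B !=set0) by move=> ?; apply: nAB; left.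
have nb : ~ cprox b A B by move=> ?; apply: nAB; right.
have [E [nAE nEB]] := cprox_split nb.
exists ((E `\` A) `|` B); split=> [[[x [Ax [[_ nAx]//|Bx]]]|AEB]|[[x [nE Bx]]|EB]].
- by apply: nI; exists x.
- move/cprox_sym/cproxU: AEB => [/cprox_sym AE|/cprox_sym//].
  by apply: nAE; apply: cprox_sub AE => // x [].
- by apply: nE; right.
- have : cprox b (~` E `|` A) B.
    apply: cprox_sub EB => // x /not_orP[nEA _].
    have [Ax|nAx] := pselect (A x); first by right.
    by left=> Ex; apply: nEA.
  by move=> /cproxU[].
Qed.

Lemma dprox_separated x y : dprox [set x] [set y] <-> x = y.
Proof.
split=> [[[z [/= <- <-//]]|/cprox_unbounded[+ _]]|->]; last by left; exists y.
by move=> /(_ (bounded_set1 b x)).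
Qed.

Definition discrete_extension : proximity X :=
  Proximity dprox_sym dprox_neq0 dprox_meet dproxU dprox_split
    dprox_separated.

Definition coarse_boundary_set : set (prox_cluster discrete_extension) :=
  [set sigma | forall B, bounded_set b B -> ~ sigma B].

Definition coarse_boundary : topologicalType := set_type coarse_boundary_set.

Definition trace (A : set X) : set coarse_boundary :=
  set_val @^-1` closure (point_clusters discrete_extension A).

End CoarseProximity.

Arguments trace {X} b A.

(* [asInd_lt n b] means asInd(X) <= n - 1. *)
Fixpoint asInd_lt (n : nat) (X : Type) (b : coarse_proximity X) : Prop :=
  if n is m.+1 then
    forall A B : set X, ~ cprox b A B ->
      exists2 C : set X, separator (trace b A) (trace b B) (trace b C) &
        asInd_lt m (coarse_sub b C)
  else bounded_set b [set: X].

Definition asInd (X : Type) (b : coarse_proximity X) : \bar int :=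
  least_dim (fun n => asInd_lt n b).

Section Freudenthal.
Variable X : topologicalType.

Definition compactly_separated (A B : set X) : Prop :=
  exists K U V : set X,
    [/\ [/\ compact K, K `&` A = set0 & K `&` B = set0],
        open U /\ open V, U `&` V = set0, ~` K = U `|` V &
        A `<=` U /\ B `<=` V].

(* Without the closures this would not be a proximity: in `[0, 1], the sets
   `[0, 1/2[ and `]1/2, 1] are separated by the compact set [set 1/2], and no E
   as in [prox_split] exists for them. For closed A and B the closures change
   nothing, nor do they change [freudenthal_cprox]. *)
Definition freudenthal_prox (A B : set X) : Prop :=
  ~ compactly_separated (closure A) (closure B).

Definition freudenthal_bounded : set (set X) :=
  [set D | compact (closure D)].

Definition freudenthal_cprox (A B : set X) : Prop :=
  forall D, freudenthal_bounded D -> freudenthal_prox (A `\` D) (B `\` D).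

Hypotheses (hX : hausdorff_space X) (lcX : locally_compact [set: X]).

Lemma compact_nbhs_avoid (K F : set X) : compact K -> closed F ->
  K `&` F = set0 -> exists W : set X,
    [/\ open W, K `<=` W, compact (closure W) & closure W `&` F = set0].
Proof.
move=> cK cF KF.
pose good (W : set X) :=
  [/\ open W, compact (closure W) & closure W `&` F = set0].
have goodU V W : good V -> good W -> good (V `|` W).
  move=> [oV cV VF] [oW cW WF]; split; first exact: openU.
    by rewrite closureU; exact: compactU.
  by rewrite closureU setIUl VF WF setU0.
pose G : set_system (set X) := filter_from good
  (fun V => [set W | good W /\ V `<=` W]).
have good0 : good set0.
  by split; rewrite ?closure0 ?set0I//; [exact: open0|exact: compact0].
have FG : Filter G.
  apply: filter_from_filter; first by exists set0.
  move=> V W gV gW; exists (V `|` W); first exact: goodU.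
  by move=> Z [gZ]; rewrite subUset => -[VZ WZ].
have [W [gW KW]] : exists W, good W /\ K `<=` W.
  have /compact_near_coveringP/(_ _ G (fun W x => W x) FG) nc := cK.
  suff /nc[V gV VK] : forall x, K x -> \forall x' \near x & W \near G, W x'.
    by exists V; split=> //; apply: VK; split.
  move=> x Kx.
  have [B] := lcX (I : [set: X] x); rewrite withinET => nB [cB clB].
  have nF : nbhs x (~` F).
    apply: open_nbhs_nbhs; split; first by rewrite openC.
    by move=> Fx; have : (K `&` F) x by []; rewrite KF.
  have nBF : nbhs x (B `&` ~` F) by exact: filterI.
  have [V nV VBF] : filter_from (nbhs x) closure (B `&` ~` F).
    exact: (compact_regular hX cB nB nBF).
  have gV : good V°.
    have VB : closure V° `<=` B `&` ~` F.
      apply: subset_trans VBF; apply: closureS; exact: interior_subset.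
    split; first exact: open_interior.
      apply: subclosed_compact cB _; first exact: closed_closure.
      by move=> y /VB[].
    by apply/seteqP; split=> // y [/VB[_ +] Fy]; exact.
  exists (V°, [set W | good W /\ V° `<=` W]) => /=; last first.
    by move=> [y W] /= [Vy [_ VW]]; exact: VW.
  split; last by exists V°.
  exact: nbhs_interior.
by exists W; case: gW.
Qed.

Lemma compactly_separated_sym A B :
  compactly_separated A B -> compactly_separated B A.
Proof.
move=> [K [U [V [[cK KA KB] [oU oV] UV KUV [AU BV]]]]].
by exists K, V, U; split; rewrite // ?[V `&` U]setIC// setUC.
Qed.

Lemma compactly_separated_sub A A' B B' : A `<=` A' -> B `<=` B' ->
  compactly_separated A' B' -> compactly_separated A B.
Proof.
move=> AA BB [K [U [V [[cK KA KB] ? ? ? [AU BV]]]]].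
exists K, U, V; split=> //; last by split; [exact: subset_trans AU|exact: subset_trans BV].
by split=> //; apply/seteqP; split=> // x [Kx ?]; [rewrite -KA|rewrite -KB]; split=> //; [exact: AA|exact: BB].
Qed.

Lemma compactly_separatedU A B C :
  compactly_separated A B -> compactly_separated A C ->
  compactly_separated A (B `|` C).
Proof.
move=> [K [U [V [[cK KA KB] [oU oV] UV KUV [AU BV]]]]].
move=> [L [U' [V' [[cL LA LC] [oU' oV'] UV' LUV [AU' CV]]]]].
have oW : open ((U `&` U') `|` (V `|` V')).
  by apply: openU; [exact: openI|exact: openU].
exists (~` ((U `&` U') `|` (V `|` V'))), (U `&` U'), (V `|` V').
split; rewrite ?setCK//.
- split.
  + apply: (@subclosed_compact _ _ (K `|` L)); [by rewrite closedC|exact: compactU|].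
    move=> x nx; have [Kx|nKx] := pselect (K x); first by left.
    have [Lx|nLx] := pselect (L x); first by right.
    exfalso; apply: nx.
    have : (U `|` V) x by rewrite -KUV.
    have : (U' `|` V') x by rewrite -LUV.
    by move=> [?|?] [?|?]; [left|right; left|right; right|right; left].
  + apply/seteqP; split=> // x [nx Ax]; apply: nx; left.
    by split; [exact: AU|exact: AU'].
  + apply/seteqP; split=> // x [nx BCx]; apply: nx; right.
    by case: BCx => [/BV|/CV]; [left|right].
- by split; [exact: openI|exact: openU].
- apply/seteqP; split=> // x [[Ux U'x] [Vx|V'x]].
    by have : (U `&` V) x by []; rewrite UV.
  by have : (U' `&` V') x by []; rewrite UV'.
- split=> x; first by split; [exact: AU|exact: AU'].
  by case=> [/BV|/CV]; [left|right].
Qed.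

Lemma compactly_separated_split_aux A K U V : closed A ->
  compact K -> K `&` A = set0 ->
  open U -> open V -> U `&` V = set0 -> ~` K = U `|` V -> A `<=` U ->
  compactly_separated A (~` U).
Proof.
move=> clA cK KA oU oV UV KUV AU.
have [W [oW KW cW WA]] := compact_nbhs_avoid cK clA KA.
have nUV x : U x -> V x -> False.
  by move=> Ux Vx; have : (U `&` V) x by []; rewrite UV.
have cases x : K x \/ U x \/ V x.
  have [Kx|nKx] := pselect (K x); first by left.
  by right; have : (U `|` V) x by rewrite -KUV.
have nKU x : U x -> K x -> False.
  move=> Ux; suff : (~` K) x by [].
  by rewrite KUV; left.
have oUW : open ((U `&` ~` closure W) `|` (V `|` W)).
  apply: openU; last exact: openU.
  by apply: openI => //; rewrite openC; exact: closed_closure.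
exists (~` ((U `&` ~` closure W) `|` (V `|` W))), (U `&` ~` closure W),
  (V `|` W).
have AUW : A `<=` U `&` ~` closure W.
  move=> x Ax; split; first exact: AU.
  by move=> Wx; have : (closure W `&` A) x by []; rewrite WA.
have UVW : ~` U `<=` V `|` W.
  by move=> x nU; have [/KW|[//|]] := cases x; [right|left].
split; rewrite ?setCK//.
- split.
  + apply: subclosed_compact cW _; first by rewrite closedC.
    move=> x nx; apply: contrapT => nW; apply: nx.
    have [/KW/subset_closure//|[Ux|Vx]] := cases x; first by left.
    by right; left.
  + by apply/seteqP; split=> // x [nx /AUW ?]; apply: nx; left.
  + by apply/seteqP; split=> // x [nx /UVW ?]; apply: nx; right.
- split; last exact: openU.
  by apply: openI => //; rewrite openC; exact: closed_closure.
- apply/seteqP; split=> // x [[Ux nW] [Vx|/subset_closure//]].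
  exact: nUV Vx.
Qed.

Lemma freudenthal_prox_sym A B : freudenthal_prox A B -> freudenthal_prox B A.
Proof. by move=> AB /compactly_separated_sym. Qed.

Lemma freudenthal_prox_sub A A' B B' : A `<=` A' -> B `<=` B' ->
  freudenthal_prox A B -> freudenthal_prox A' B'.
Proof.
by move=> AA BB AB s; apply: AB; apply: compactly_separated_sub s; exact: closureS.
Qed.

Lemma freudenthal_prox_neq0 A B :
  freudenthal_prox A B -> A !=set0 /\ B !=set0.
Proof.
have ne C D : freudenthal_prox C D -> C !=set0.
  move=> CD; apply/set0P/eqP => C0; apply: CD; rewrite C0 closure0.
  exists set0, set0, setT; split; rewrite ?set0I ?set0U ?setC0//.
  - by split=> //; exact: compact0.
  - by split; [exact: open0|exact: openT].
  - by split=> // x.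
by move=> AB; split; [exact: ne AB|apply: ne (freudenthal_prox_sym AB)].
Qed.

Lemma freudenthal_prox_meet A B : A `&` B !=set0 -> freudenthal_prox A B.
Proof.
move=> [x [Ax Bx]] [K [U [V [_ _ UV _ [AU BV]]]]].
suff : (U `&` V) x by rewrite UV.
by split; [apply: AU|apply: BV]; exact: subset_closure.
Qed.

Lemma freudenthal_proxU A B C :
  freudenthal_prox A (B `|` C) <-> freudenthal_prox A B \/ freudenthal_prox A C.
Proof.
split=> [AB|[]]; last 2 first.
- by apply: freudenthal_prox_sub => // ?; left.
- by apply: freudenthal_prox_sub => // ?; right.
apply: contrapT => /not_orP[/contrapT sB /contrapT sC]; apply: AB.
by rewrite closureU; exact: compactly_separatedU.
Qed.

Lemma freudenthal_prox_split A B : ~ freudenthal_prox A B ->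
  exists E, ~ freudenthal_prox A E /\ ~ freudenthal_prox (~` E) B.
Proof.
move=> /contrapT[K [U [V [[cK KA KB] [oU oV] UV KUV [AU BV]]]]].
have clN (O : set X) : open O -> closure (~` O) = ~` O.
  by move=> oO; apply/esym/closure_id; rewrite closedC.
exists (~` U); split; apply; rewrite ?setCK.
  rewrite clN//.
  apply: (@compactly_separated_split_aux _ K _ V) => //.
  exact: closed_closure.
apply: (@compactly_separated_sub _ (~` V) _ (closure B)) => //.
  rewrite -(clN V)//; apply: closureS => x Ux Vx.
  by have : (U `&` V) x by []; rewrite UV.
apply: compactly_separated_sym.
apply: (@compactly_separated_split_aux _ K _ U) => //.
- exact: closed_closure.
- by rewrite setIC.
- by rewrite setUC.
Qed.

Lemma freudenthal_prox_separated x y :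
  freudenthal_prox [set x] [set y] <-> x = y.
Proof.
split=> [xy|->]; last by apply: freudenthal_prox_meet; exists y.
have cl1 (z : X) : closed [set z].
  exact: (compact_closed hX (@compact_set1 _ _)).
apply: contrapT => nxy; apply: xy.
rewrite -!(closure_id _).1//.
have xy0 : [set x] `&` [set y] = set0.
  by apply/seteqP; split=> // z [/= -> ].
have [W [oW xW cW Wy]] := compact_nbhs_avoid (@compact_set1 _ x) (cl1 y) xy0.
have clW : closed (~` W) by rewrite closedC.
have xW0 : [set x] `&` ~` W = set0.
  by apply/seteqP; split=> // z [/xW].
have [V [oV xV cV VW]] := compact_nbhs_avoid (@compact_set1 _ x) clW xW0.
have oVW : open (V `|` ~` closure V).
  by apply: openU => //; rewrite openC; exact: closed_closure.
exists (~` (V `|` ~` closure V)), V, (~` closure V).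
have nVy : ~ closure V y.
  move=> Vy; have : (closure W `&` [set y]) y.
    split=> //; apply: subset_closure; apply: contrapT => nW.
    by have : (closure V `&` ~` W) y by []; rewrite VW.
  by rewrite Wy.
split; rewrite ?setCK//.
+ split.
  * apply: subclosed_compact cV _; first by rewrite closedC.
    by move=> z nz; apply: contrapT => nV; apply: nz; right.
  * by apply/seteqP; split=> // z [nz /xV ?]; apply: nz; left.
  * by apply/seteqP; split=> // z [nz /= zy]; apply: nz; right; rewrite zy.
+ by split=> //; rewrite openC; exact: closed_closure.
+ by apply/seteqP; split=> // z [/subset_closure].
+ by split=> // z /= ->.
Qed.

Definition freudenthal_proximity : proximity X :=
  Proximity freudenthal_prox_sym freudenthal_prox_neq0 freudenthal_prox_meet
    freudenthal_proxU freudenthal_prox_split freudenthal_prox_separated.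

(* The points of X are the clusters that contain a singleton. *)
Definition freudenthal_boundary : topologicalType :=
  set_type (~` point_clusters freudenthal_proximity [set: X]).

Lemma freudenthal_bounded0 : freudenthal_bounded set0.
Proof. by rewrite /freudenthal_bounded /= closure0; exact: compact0. Qed.

Lemma freudenthal_bounded1 x : freudenthal_bounded [set x].
Proof.
rewrite /freudenthal_bounded /= -(closure_id _).1; first exact: compact_set1.
exact: (compact_closed hX (@compact_set1 _ _)).
Qed.

Lemma freudenthal_bounded_sub A B :
  A `<=` B -> freudenthal_bounded B -> freudenthal_bounded A.
Proof.
move=> AB cB; apply: subclosed_compact cB _; first exact: closed_closure.
exact: closureS.
Qed.

Lemma freudenthal_boundedU A B :
  freudenthal_bounded A -> freudenthal_bounded B ->
  freudenthal_bounded (A `|` B).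
Proof. by rewrite /freudenthal_bounded /= closureU; exact: compactU. Qed.

Lemma freudenthal_cprox_sym A B :
  freudenthal_cprox A B -> freudenthal_cprox B A.
Proof. by move=> AB D /AB /freudenthal_prox_sym. Qed.

Lemma freudenthal_cprox_sub A A' B B' : A `<=` A' -> B `<=` B' ->
  freudenthal_cprox A B -> freudenthal_cprox A' B'.
Proof.
move=> AA BB AB D /AB; apply: freudenthal_prox_sub; exact: setSD.
Qed.

Lemma freudenthal_cprox_unbounded A B : freudenthal_cprox A B ->
  ~ freudenthal_bounded A /\ ~ freudenthal_bounded B.
Proof.
by move=> AB; split=> /AB; rewrite setDv => /freudenthal_prox_neq0[[? +] [? +]].
Qed.

Lemma freudenthal_cprox_meet A B :
  ~ freudenthal_bounded (A `&` B) -> freudenthal_cprox A B.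
Proof.
move=> uAB D bD; apply: freudenthal_prox_meet; apply: contrapT => nAB.
apply: uAB; apply: freudenthal_bounded_sub bD => x [Ax Bx].
by apply: contrapT => nDx; apply: nAB; exists x.
Qed.

Lemma freudenthal_cproxU A B C : freudenthal_cprox (A `|` B) C <->
  freudenthal_cprox A C \/ freudenthal_cprox B C.
Proof.
split=> [ABC|[]]; last 2 first.
- by apply: freudenthal_cprox_sub => // ?; left.
- by apply: freudenthal_cprox_sub => // ?; right.
apply: contrapT => /not_orP[/existsNP[D /not_implyP[bD nD]]].
move=> /existsNP[E /not_implyP[bE nE]].
have := ABC _ (freudenthal_boundedU bD bE).
move=> /freudenthal_prox_sym; rewrite setDUl => /freudenthal_proxU[].
- move=> /freudenthal_prox_sym h; apply: nD; apply: freudenthal_prox_sub h.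
    by apply: setDS => ?; left.
  by apply: setDS => ?; left.
- move=> /freudenthal_prox_sym h; apply: nE; apply: freudenthal_prox_sub h.
    by apply: setDS => ?; right.
  by apply: setDS => ?; right.
Qed.

Lemma freudenthal_cprox_split A B : ~ freudenthal_cprox A B ->
  exists E, ~ freudenthal_cprox A E /\ ~ freudenthal_cprox (~` E) B.
Proof.
move=> /existsNP[D /not_implyP[bD /freudenthal_prox_split[E [nAE nEB]]]].
exists E; split=> /(_ _ bD) h.
- by apply: nAE; apply: freudenthal_prox_sub h => // x [].
- by apply: nEB; apply: freudenthal_prox_sub h => // x [].
Qed.

Definition freudenthal_coarse : coarse_proximity X :=
  CoarseProximity freudenthal_bounded0 freudenthal_bounded1
    freudenthal_bounded_sub freudenthal_boundedU freudenthal_cprox_sym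
    freudenthal_cprox_unbounded freudenthal_cprox_meet freudenthal_cproxU
    freudenthal_cprox_split.

End Freudenthal.

(* Main.v *)
Require Import Defs.
From mathcomp Require Import all_boot all_order all_algebra.
From mathcomp Require Import all_classical all_reals.
From mathcomp Require Import ereal topology.

Set Implicit Arguments.
Unset Strict Implicit.
Unset Printing Implicit Defensive.

Local Open Scope classical_set_scope.

(** The three dimensions agree because none of them exceeds 0, and each of them
is -1 exactly when X is compact.

The space at infinity of X has a base of clopen sets. Indeed, suppose that A
and B are not close at infinity. Off a bounded set they are then separated by a
compact set K: the complement of K splits into disjoint open sets U and V, where
U contains almost all of A and V almost all of B. Enlarging K to a relatively
compact neighbourhood shows that U and its complement are themselves not close
at infinity ([freudenthal_splits]). Hence no cluster without bounded sets
contains both U and its complement, and the clusters containing U form a clopen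
set of the boundary ([clopen_far_mem]).

It follows that the empty set separates the traces of A and B, and the empty
set is bounded, so that asInd(X) <= 0 ([asInd_lt1]). It also follows that the
boundary is totally disconnected; being closed in a Smirnov compactification it
is compact, and a compact totally disconnected space has Ind <= 0
([Ind_lt1_zero_dimensional]).

Both boundaries are treated at once. The discrete extension of the coarse
proximity and the Freudenthal proximity each form, together with the bounded
sets, a local proximity space in the sense of Leader ([local_structure]), with
the same coarse proximity. In both cases the boundary is the set of clusters
that contain no bounded set ([far_clusters]): by definition for the discrete
extension, and for the Freudenthal proximity because a cluster that contains a
compact set is a point ([compact_cluster_point]). An ultrafilter of
complements of bounded sets yields such a cluster as soon as X is unbounded
([far_clusters_eq0]). *)

(** * Dimensions at most zero *)

Lemma eq_least_dim (P Q : nat -> Prop) :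
  (P 0 <-> Q 0) -> P 1 -> Q 1 -> least_dim P = least_dim Q.
Proof.
move=> PQ0 P1 Q1; rewrite /least_dim.
case: pselect => [exP|[]]; last by exists 1; exact/asboolP.
case: pselect => [exQ|[]]; last by exists 1; exact/asboolP.
suff -> : ex_minn exP = ex_minn exQ by [].
case: ex_minnP => m /asboolP Pm minP; case: ex_minnP => n /asboolP Qn minQ.
have m1 : m <= 1 by apply: minP; exact/asboolP.
have n1 : n <= 1 by apply: minQ; exact/asboolP.
have m0 : P 0 -> m = 0 by move=> /asboolP/minP; case: (m).
have n0 : Q 0 -> n = 0 by move=> /asboolP/minQ; case: (n).
case: m Pm m1 m0 {minP} => [|[|//]] Pm _ m0; first by rewrite n0//; exact/PQ0.
by case: n Qn n1 n0 {minQ} => [|[|//]] Qn _ n0; rewrite // m0//; exact/PQ0.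
Qed.

(** * Compact totally disconnected spaces *)

Section ZeroDimensional.
Variable T : topologicalType.

(** If every set W of the family met K, then the sets W `&` K would generate a
proper filter on K, and a cluster point of it would lie in every W. *)
Lemma clopen_avoid (K : set T) (Wf : set (set T)) : compact K ->
  Wf setT -> setI_closed Wf -> (forall W, Wf W -> closed W) ->
  (forall x, K x -> exists2 W, Wf W & ~ W x) ->
  exists2 W, Wf W & W `&` K = set0.
Proof.
move=> cK WT WI Wcl Wavoid; apply: contrapT => nW.
pose F : set_system T := filter_from Wf (fun W => W `&` K).
have FF : ProperFilter F.
  apply: filter_from_proper; last first.
    by move=> W wW; apply/set0P/eqP => W0; apply: nW; exists W.
  apply: filter_from_filter; first by exists setT.
  move=> V W wV wW; exists (V `&` W); first exact: WI.
  by move=> x [[Vx Wx] Kx].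
have FK : F K by exists setT => // x [].
have [x [Kx Fx]] := cK F FF FK.
have [W wW nWx] := Wavoid x Kx.
have FW : F (W `&` K) by exists W.
have nx : nbhs x (~` W).
  by apply: open_nbhs_nbhs; split => //; rewrite openC; exact: Wcl.
by have [y [[Wy _]]] := Fx _ _ FW nx; exact.
Qed.

(** Two applications of [clopen_avoid]: a point y off A has a clopen
neighbourhood missing A, since y can be told from each point of A; the
complements of these neighbourhoods then tell A from each point of B. *)
Lemma compact_zero_dimensional_clopen (A B : set T) :
  compact [set: T] -> zero_dimensional T -> closed A -> closed B ->
  A `&` B = set0 -> exists W, [/\ clopen W, A `<=` W & B `<=` ~` W].
Proof.
move=> cT zT clA clB AB.
have clT : @clopen T setT by split; [exact: openT|exact: closedT].
have pt y : ~ A y -> exists2 W, clopen W /\ W y & W `&` A = set0.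
  move=> nAy; apply: (@clopen_avoid A [set W | clopen W /\ W y]) => //.
  - by apply: (subclosed_compact clA cT).
  - by move=> V W [cV Vy] [cW Wy]; split; [exact: clopenI|].
  - by move=> W [[]].
  - move=> x Ax; have /eqP/zT : y <> x by move=> yx; apply: nAy; rewrite yx.
    by move=> [W [cW Wy nWx]]; exists W.
have [W [cW AW] WB] : exists2 W, clopen W /\ A `<=` W & W `&` B = set0.
  apply: (@clopen_avoid B [set W | clopen W /\ A `<=` W]) => //.
  - by apply: (subclosed_compact clB cT).
  - by move=> V W [cV AV] [cW AW]; split; [exact: clopenI|rewrite subsetI].
  - by move=> W [[]].
  - move=> y By; have [|W [cW Wy] WA] := pt y.
      by move=> Ay; have : (A `&` B) y by []; rewrite AB.
    exists (~` W); last by move/(_ Wy).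
    split; first exact: clopenC.
    by move=> x Ax Wx; have : (W `&` A) x by []; rewrite WA.
exists W; split=> // y By Wy.
by have : (W `&` B) y by []; rewrite WB.
Qed.

Lemma clopen_separator (A B W : set T) :
  clopen W -> A `<=` W -> B `<=` ~` W -> separator A B set0.
Proof.
move=> [oW cW] AW BW; exists W, (~` W).
by split; rewrite ?setICr ?setC0 ?setUv//; split => //; rewrite openC.
Qed.

Lemma Ind_lt1_zero_dimensional :
  compact [set: T] -> zero_dimensional T -> Ind_lt 1 T.
Proof.
move=> cT zT A B clA clB AB.
have [W [cW AW BW]] := compact_zero_dimensional_clopen cT zT clA clB AB.
exists set0; first exact: clopen_separator BW.
by apply/seteqP; split=> // -[x x0]; have := set_mem x0.
Qed.

Lemma compact_set_type (P : set T) : closed P -> compact [set: T] ->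
  compact [set: set_type P].
Proof.
move=> clP cT F FF _.
have cP : compact P by exact: (subclosed_compact clP cT).
have FP : (set_val @ F) P.
  suff -> : (set_val @ F) P = F setT by exact: filterT.
  by congr (F _); apply/seteqP; split=> // -[x xP] _; exact: set_mem xP.
have [x [Px Fx]] := cP (set_val @ F) _ FP.
exists (exist _ x (mem_set Px)); split => // A N FA [_ [[O oO <-] Ox] ON].
have nO : nbhs x O by apply: open_nbhs_nbhs.
have FA' : (set_val @ F) (set_val @` A).
  by rewrite /fmap /=; apply: filterS FA => y Ay; exists y.
have [_ [[y Ay <-] Oy]] := Fx _ _ FA' nO.
by exists y; split => //; exact: ON.
Qed.

End ZeroDimensional.

(** * Clusters and compactness of the Smirnov compactification *)

Section Clusters.
Variables (X : Type) (d : proximity X).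

Lemma proxNr (A B B' : set X) : B `<=` B' -> ~ d A B' -> ~ d A B.
Proof. by move=> BB nAB' /(prox_sub BB). Qed.

Lemma cluster_or (s : prox_cluster d) (A B C : set X) :
  s C -> C `<=` A `|` B -> s A \/ s B.
Proof. by move=> sC CAB; apply: clusterU; exact: cluster_sub CAB sC. Qed.

Lemma cluster_ext (s t : prox_cluster d) : (forall A, s A <-> t A) -> s = t.
Proof.
case: s t => [s s1 s2 s3 s4] [t t1 t2 t3 t4] /= st.
have {}st : s = t by apply/funext => A; exact/propext.
by subst t; f_equal; exact: Prop_irrelevance.
Qed.

(** If all members of s were near all members of t, then maximality would make
each of the two clusters contain the other. *)
Lemma distinct_clusters (s t : prox_cluster d) : s <> t ->
  exists A B, [/\ s A, t B & ~ d A B].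
Proof.
move=> nst; apply: contrapT => near; apply: nst.
have {}near A B : s A -> t B -> d A B.
  by move=> sA tB; apply: contrapT => nAB; apply: near; exists A, B.
apply: cluster_ext => A; split=> [sA|tA]; apply: cluster_max => B ?.
  exact: near.
by apply: prox_sym; exact: near.
Qed.

(** The common source of all clusters constructed here. The cluster consists of
the sets near every member of G. When A is far from a member of G, the
splitting axiom gives a set E far from A whose complement is not in G; the
intersection of two such sets is still in G, which is why a union of two sets
outside the cluster is outside as well. *)
Lemma clan_cluster (G : set (set X)) : G setT ->
  (forall A B, G A -> G B -> d A B) ->
  (forall A B, G (A `|` B) -> G A \/ G B) ->
  exists s : prox_cluster d, forall A, G A -> s A.
Proof.
move=> GT Gnear GU.
pose S A := forall B, G B -> d A B.
have GC E : G E \/ G (~` E) by apply: GU; rewrite setUv.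
have enlarge A B : G B -> ~ d A B -> exists2 E, G E /\ ~ G (~` E) & ~ d A E.
  move=> GB /prox_split[E [nAE nEB]]; exists E => //.
  have nE : ~ G (~` E) by move=> GE; apply: nEB; exact: Gnear.
  by split=> //; case: (GC E).
have S0 A : S A -> A !=set0 by move=> /(_ _ GT) /prox_neq0[].
have Snear A B : S A -> S B -> d A B.
  move=> SA SB; apply: contrapT => /prox_split[E [nAE nEB]].
  have [/SA//|/SB /prox_sym] := GC E; exact: nEB.
have GS A : G A -> S A by move=> GA B GB; exact: Gnear.
have Smax C : (forall A, S A -> d C A) -> S C.
  by move=> SC A /GS /SC.
have SU A B : S (A `|` B) -> S A \/ S B.
  move=> SAB; apply: contrapT => /not_orP[].
  move=> /existsNP[C /not_implyP[GC' /(enlarge _ _ GC')[E [GE nGE] nAE]]].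
  move=> /existsNP[D /not_implyP[GD /(enlarge _ _ GD)[F [GF nGF] nBF]]].
  have GEF : G (E `&` F).
    have [//|] := GC (E `&` F).
    by rewrite setCI => /GU[].
  have /prox_sym/proxU[/prox_sym|/prox_sym] := SAB _ GEF.
    by apply: proxNr nAE => x [].
  by apply: proxNr nBF => x [].
by exists (ProxCluster S0 Snear Smax SU) => A /GS.
Qed.

Lemma closed_cluster_mem (A : set X) : closed [set s : prox_cluster d | s A].
Proof.
apply/closure_id/seteqP; split; first exact: subset_closure.
rewrite closure_smirnovE => s /smirnov_prox1P; apply.
by move=> t.
Qed.

(** The sets A such that F-almost every cluster contains A form a clan, and F
converges to a cluster extending it. *)
Lemma smirnov_compact : compact [set: prox_cluster d].
Proof.
rewrite compact_ultra => F UF _.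
have [|A B FA FB|A B FAB|s Gs] := @clan_cluster [set A | F [set s | s A]].
- apply: (@filterS _ F _ setT) => [s _|]; last exact: filterT.
  apply: cluster_max => A.
  by move=> /cluster_neq0[x Ax]; apply: prox_meet; exists x.
- have [s [sA sB]] := @filter_ex _ F _ _ (@filterI _ F _ _ _ FA FB).
  exact: cluster_near sA sB.
- have [|nFA] := in_ultra_setVsetC [set s : prox_cluster d | s A] UF.
    by left.
  right; apply: (@filterS _ F _ _ _ _ (@filterI _ F _ _ _ FAB nFA)).
  by move=> s [/clusterU[]].
exists s; split=> //=.
rewrite -[_ --> _]/([set _ | _] s) -ultra_cvg_clusterE clusterE => S FS.
rewrite closure_smirnovE; apply/smirnov_prox1P => C CS; apply: Gs.
exact: filterS CS FS.
Qed.

Lemma closure_point_clusters (A : set X) :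
  closure (point_clusters d A) `<=` [set s | s A].
Proof.
rewrite [X in _ `<=` X](closure_id _).1; last exact: closed_cluster_mem.
apply: closureS => s [x Ax sx]; apply: cluster_sub sx => _ -> //.
Qed.

End Clusters.

(** * The boundary of a local proximity space *)

Section FarClusters.
Variables (X : Type) (d : proximity X) (b : coarse_proximity X).

Definition far_clusters : set (prox_cluster d) :=
  [set s | forall B, bounded_set b B -> ~ s B].

(** The axioms linking the bounded sets and the proximity of a local proximity
space, for which b is the induced nearness at infinity: every bounded set has a
bounded proximal neighbourhood D. *)
Definition local_structure : Prop :=
  (forall A B, cprox b A B <->
     forall D, bounded_set b D -> d (A `\` D) (B `\` D)) /\
  (forall B, bounded_set b B -> exists2 D, bounded_set b D & ~ d B (~` D)).

(** The splitting axiom made sharp: the set E there leaves room between A and B,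
whereas U leaves none, no point at infinity being adherent to both U and its
complement. This is zero-dimensionality at infinity. *)
Definition splits_at_infinity : Prop :=
  forall A B, ~ cprox b A B -> exists U,
    [/\ ~ cprox b U (~` U), bounded_set b (A `\` U) & bounded_set b (B `&` U)].

Hypothesis locdb : local_structure.

Lemma cluster_full (s : prox_cluster d) : s setT.
Proof.
by apply: cluster_max => A /cluster_neq0[x Ax]; apply: prox_meet; exists x.
Qed.

Lemma far_sub (s : prox_cluster d) (A B : set X) : far_clusters s -> s A ->
  bounded_set b (A `\` B) -> s B.
Proof.
move=> fs sA bAB; have [//|sAB] : s B \/ s (A `\` B).
  apply: cluster_or sA _ => x Ax.
  by have [|] := pselect (B x); [left|right].
by case: (fs _ bAB sAB).
Qed.

Lemma far_near (s : prox_cluster d) (A B : set X) :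
  far_clusters s -> s A -> s B -> cprox b A B.
Proof.
move=> fs sA sB; apply/locdb.1 => D bD.
have inD C : s C -> s (C `\` D).
  move=> sC; apply: (far_sub fs sC); apply: bounded_subset bD => x [Cx nCD].
  by apply: contrapT => nD; apply: nCD.
exact: cluster_near (inD _ sA) (inD _ sB).
Qed.

(** This expresses that the far clusters form a closed set: a cluster with a
bounded member misses the complement of a bounded neighbourhood of it, whereas
all such complements belong to every far cluster. *)
Lemma not_far_cluster (s : prox_cluster d) : ~ far_clusters s ->
  exists2 D, bounded_set b D & ~ s (~` D).
Proof.
move=> /existsNP[B /not_implyP[bB /contrapT sB]].
have [D bD nBD] := locdb.2 _ bB.
by exists D => // sD; apply: nBD; exact: cluster_near sB sD.
Qed.

Lemma farC (s : prox_cluster d) (D : set X) :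
  far_clusters s -> bounded_set b D -> s (~` D).
Proof.
move=> fs bD; apply: (far_sub fs (cluster_full s)).
by rewrite setTD setCK.
Qed.

Lemma closed_far_clusters : closed far_clusters.
Proof.
suff -> : far_clusters =
    \bigcap_(D in bounded_set b) [set s : prox_cluster d | s (~` D)].
  by apply: closed_bigI => D _; exact: closed_cluster_mem.
apply/seteqP; split=> [s fs D bD|s sC]; first exact: farC.
by apply: contrapT => /not_far_cluster[D /sC].
Qed.

(** On an unbounded X, the complements of bounded sets lie in an ultrafilter,
which is a clan; a cluster extending it contains them all and is far. *)
Lemma far_clusters_eq0 : far_clusters = set0 <-> bounded_set b setT.
Proof.
split=> [f0|bT]; last first.
  by apply/seteqP; split=> // s fs; case: (fs _ bT); exact: cluster_full.
apply: contrapT => ubT.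
pose F0 : set_system X := [set S | bounded_set b (~` S)].
have PF0 : ProperFilter F0.
  split; first by rewrite /F0 /= setC0.
  split.
  - by rewrite /F0 /= setCT; exact: bounded_set0.
  - by move=> S T bS bT; rewrite /F0 /= setCI; exact: bounded_setU.
  - move=> S T ST; apply: bounded_subset; exact: subsetC.
have [F [UF F0F]] := ultraFilterLemma PF0.
have [|A B FA FB|A B FAB|s Fs] := @clan_cluster _ d F.
- exact: filterT.
- by apply: prox_meet; exact: filter_ex (filterI FA FB).
- have [|nFA] := in_ultra_setVsetC A UF; first by left.
  by right; apply: filterS (filterI FAB nFA) => x [[]].
suff : far_clusters s by rewrite f0.
apply: contrapT => /not_far_cluster[D bD]; apply; apply: Fs.
by apply: F0F; rewrite /F0 /= setCK.
Qed.

(** Membership of a fixed set is a closed condition on clusters, and on the far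
clusters membership of the complement of U is the negation of membership
of U. *)
Lemma clopen_far_mem (U : set X) : ~ cprox b U (~` U) ->
  clopen [set s : set_type far_clusters | set_val s U].
Proof.
have clm A : closed [set s : set_type far_clusters | set_val s A].
  have /continuous_closedP :=
    @initial_continuous (set_type far_clusters) _ set_val.
  by move=> /(_ _ (@closed_cluster_mem _ d A)).
move=> nU; split; last exact: clm.
rewrite -closedC.
suff -> : ~` [set s : set_type far_clusters | set_val s U] =
    [set s : set_type far_clusters | set_val s (~` U)] by exact: clm.
apply/seteqP; split=> -[s fs] /= => [nsU|sC sU].
  have [//|//] : s U \/ s (~` U).
  by apply: cluster_or (cluster_full s) _; rewrite setUv.
by apply: nU; exact: far_near (set_mem fs) sU sC.
Qed.

Hypothesis splitb : splits_at_infinity.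

Lemma zero_dimensional_far_clusters : zero_dimensional (set_type far_clusters).
Proof.
move=> s t /eqP st.
have [A [B [sA tB nAB]]] : exists A B,
    [/\ set_val s A, set_val t B & ~ d A B].
  by apply: distinct_clusters => /val_inj.
have [|U [nU bA bB]] := @splitb A B.
  by move=> /locdb.1/(_ _ (bounded_set0 b)); rewrite !setD0.
exists [set r : set_type far_clusters | set_val r U]; split.
  exact: clopen_far_mem.
  by apply: far_sub sA bA; exact: set_mem (valP s).
move=> /= tU; have ft : far_clusters (set_val t) := set_mem (valP t).
apply: nU; apply: (far_near ft tU); apply: (far_sub ft tB).
by rewrite setDE setCK.
Qed.

Lemma Ind_lt1_far_clusters : Ind_lt 1 (set_type far_clusters).
Proof.
apply: Ind_lt1_zero_dimensional; last exact: zero_dimensional_far_clusters.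
apply: compact_set_type; first exact: closed_far_clusters.
exact: smirnov_compact.
Qed.

Lemma Ind_lt0_far_clusters :
  Ind_lt 0 (set_type far_clusters) <-> bounded_set b setT.
Proof.
split=> [T0|/far_clusters_eq0 f0].
  apply/far_clusters_eq0/seteqP; split=> // s fs.
  suff : set0 (exist _ s (mem_set fs) : set_type far_clusters) by [].
  by rewrite -T0.
apply/seteqP; split=> // -[s fs].
by suff : set0 s by []; rewrite -f0; exact: set_mem.
Qed.

End FarClusters.

(** * Asymptotic dimension *)

Section AsymptoticDimension.
Variables (X : Type) (b : coarse_proximity X).

Lemma local_discrete_extension : local_structure (discrete_extension b) b.
Proof.
split=> [A B|B bB]; last first.
  exists B => // -[|/cprox_unbounded[]//].
  by rewrite setICr => -[].
split=> [AB D bD|AB].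
  (* Removing a bounded set does not affect nearness at infinity. *)
  right; apply: contrapT => nAB.
  have decomp (C : set X) : C `<=` (C `\` D) `|` D.
    by move=> x Cx; have [|] := pselect (D x); [right|left].
  have := cprox_sub (decomp A) (decomp B) AB.
  move=> /cproxU[/cprox_sym/cproxU[/cprox_sym//|]|];
    by move=> /cprox_unbounded[].
(* If the intersection is bounded, then removing it makes A and B disjoint, so
   that they can only be near at infinity. *)
have [bAB|] := pselect (bounded_set b (A `&` B)); last exact: cprox_meet.
have [[x [[Ax nABx] [Bx _]]]|] := AB _ bAB; first by case: nABx.
by apply: cprox_sub; exact: subDsetl.
Qed.

(** The empty set is an asymptotic separator: the far clusters that contain U
form a clopen set separating the two traces. *)
Lemma asInd_lt1 : splits_at_infinity b -> asInd_lt 1 b.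
Proof.
move=> splitb A B nAB; have [U [nU bA bB]] := splitb _ _ nAB.
exists set0; last first.
  apply/sboundedE; apply: bounded_subset (bounded_set0 b) => _ [[y yP] _ <-].
  exact: set_mem yP.
have -> : trace b set0 = set0.
  by apply/seteqP; split=> // s /closure_point_clusters/cluster_neq0[].
apply: (@clopen_separator _ _ _ [set s : coarse_boundary b | set_val s U]).
- exact: (clopen_far_mem local_discrete_extension nU).
- move=> s /closure_point_clusters sA.
  by apply: far_sub sA bA; exact: set_mem (valP s).
- move=> s /closure_point_clusters sB sU.
  have fs := set_mem (valP s).
  apply: nU; apply: (far_near local_discrete_extension fs sU).
  by apply: (far_sub fs sB _); rewrite setDE setCK.
Qed.

Lemma asInd_eq_Ind : splits_at_infinity b ->
  asInd b = Ind (coarse_boundary b).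
Proof.
move=> splitb; apply: eq_least_dim.
- exact: iff_sym (Ind_lt0_far_clusters local_discrete_extension).
- exact: asInd_lt1.
- exact: Ind_lt1_far_clusters local_discrete_extension splitb.
Qed.

Lemma Ind_far_clusters (d : proximity X) : local_structure d b ->
  splits_at_infinity b ->
  Ind (coarse_boundary b) = Ind (set_type (@far_clusters _ d b)).
Proof.
move=> locdb splitb; apply: eq_least_dim.
- apply: iff_trans (Ind_lt0_far_clusters local_discrete_extension) _.
  exact: iff_sym (Ind_lt0_far_clusters locdb).
- exact: Ind_lt1_far_clusters local_discrete_extension splitb.
- exact: Ind_lt1_far_clusters.
Qed.

End AsymptoticDimension.

(** * The Freudenthal structure *)

Section Freudenthal.
Variables (X : topologicalType) (hX : hausdorff_space X).
Variable lcX : locally_compact [set: X].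
Let bF := freudenthal_coarse hX lcX.
Let dF := freudenthal_proximity hX lcX.

Lemma compact_nbhs (K : set X) : compact K ->
  exists W, [/\ open W, K `<=` W & compact (closure W)].
Proof.
move=> cK; have [|W [oW KW cW _]] := compact_nbhs_avoid hX lcX cK (@closed0 X).
  by rewrite setI0.
by exists W.
Qed.

(** A relatively compact neighbourhood W of the closure of B is proximal: B and
the complement of W are separated by a compact set between them. *)
Lemma local_freudenthal : local_structure dF bF.
Proof.
split=> // B bB.
have [W [oW BW cW]] := compact_nbhs bB.
exists W => //; apply => /=.
apply: compactly_separated_sym.
rewrite -(closure_id (~` W)).1; last by rewrite closedC.
rewrite -[X in compactly_separated _ X]setCK.
apply: (@compactly_separated_split_aux _ hX lcX _ (closure B) _ set0) => //.
- by rewrite closedC.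
- by apply/seteqP; split=> // x [/BW].
- by rewrite openC; exact: closed_closure.
- exact: open0.
- by rewrite setI0.
- by rewrite setU0.
- by move=> x nW /BW.
Qed.

(** U is one side of a compact separation of the two sets. Its boundary lies
in K, so outside a neighbourhood W of K the closures of U and of its
complement, which consists of V up to K, are separated by K. *)
Lemma freudenthal_splits : splits_at_infinity bF.
Proof.
move=> A B /existsNP[D /not_implyP[bD /contrapT]].
move=> [K [U [V [[cK KA KB] [oU oV] UV KUV [AU BV]]]]].
have nUV x : U x -> V x -> False.
  by move=> Ux Vx; have : (U `&` V) x by []; rewrite UV.
exists U; split; last 2 first.
- apply: freudenthal_bounded_sub bD => x [Ax nUx]; apply: contrapT => nDx.
  by apply/nUx/AU/subset_closure.
- apply: freudenthal_bounded_sub bD => x [Bx Ux]; apply: contrapT => nDx.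
  by apply: (nUV x) => //; apply/BV/subset_closure.
have [W [oW KW cW]] := compact_nbhs cK.
move=> /(_ W cW); apply.
have clKW (S : set X) : closure (S `\` W) `<=` closure S `&` ~` K.
  move=> x Sx; split; first by apply: closureS Sx; exact: subDsetl.
  move=> /KW Wx; have [y [[_ nWy] Wy]] := Sx W (open_nbhs_nbhs (conj oW Wx)).
  exact: nWy.
exists K, U, V; split=> //.
- by split=> //; apply/seteqP; split=> // x [Kx /clKW[_]].
- split=> x /clKW[Sx]; rewrite KUV => -[]// Vx.
    have [y [Uy Vy]] := Sx V (open_nbhs_nbhs (conj oV Vx)).
    by case: (nUV y).
  have [y [nUy Uy]] := Sx U (open_nbhs_nbhs (conj oU Vx)).
  by case: nUy.
Qed.

(** The sets S such that s does not contain K `\` S form a filter, proper because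
K is in s. The singleton of a cluster point of this filter in K is near every
member of s. *)
Lemma compact_cluster_point (s : prox_cluster dF) (K : set X) :
  compact K -> s K -> exists2 x, K x & s [set x].
Proof.
move=> cK sK.
pose G : set_system X := [set S | ~ s (K `\` S)].
have PG : ProperFilter G.
  split; first by rewrite /G /= setD0.
  split.
  - by rewrite /G /= setDT => /cluster_neq0[].
  - by move=> S T nS nT; rewrite /G /= setDIr => /clusterU[].
  - move=> S T ST nS sT; apply: nS; apply: cluster_sub sT; exact: setDS.
have GK : G K by rewrite /G /= setDv => /cluster_neq0[].
have [x [Kx Gx]] := cK G PG GK; exists x => //.
apply: cluster_max => A sA; apply: contrapT => /prox_split[E [nxE nEA]].
have GE : G E.
  move=> sE; apply: nEA; apply: cluster_near sA.
  by apply: cluster_sub sE => y [].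
apply: nxE => -[L [U [V [_ [oU oV] UV _ [xU EV]]]]].
have nx : nbhs x U.
  by apply: open_nbhs_nbhs; split=> //; apply/xU/subset_closure.
have [y [Ey Uy]] := Gx _ _ GE nx.
suff : (U `&` V) y by rewrite UV.
by split=> //; apply/EV/subset_closure.
Qed.

Lemma freudenthal_boundaryE :
  ~` point_clusters dF [set: X] = @far_clusters _ dF bF.
Proof.
apply/seteqP; split=> s.
  move=> nps B bB sB; apply: nps.
  have sclB := cluster_sub (@subset_closure _ B) sB.
  have [x _ sx] := compact_cluster_point bB sclB.
  by exists x.
by move=> fs [x _]; apply: fs; exact: bounded_set1.
Qed.

End Freudenthal.

Theorem corollary5p5 (R : realType) (X : topologicalType)
    (lcX : locally_compact [set: X]) (sepX : separable_space X)
    (metX : metrizable R X)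
    (cQX : compact [set: quasi_component_space X]) :
  let hX := metrizable_hausdorff metX in
  let bF := freudenthal_coarse hX lcX in
  asInd bF = Ind (coarse_boundary bF) /\
  Ind (coarse_boundary bF) = Ind (freudenthal_boundary hX lcX).
Proof.
move=> hX bF; split; first by apply: asInd_eq_Ind; exact: freudenthal_splits.
rewrite /freudenthal_boundary freudenthal_boundaryE.
by apply: Ind_far_clusters; [exact: local_freudenthal|exact: freudenthal_splits].
Qed.
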